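(* Let $H^\star=-\sup_{\phi\in C^0_\gamma(\Omega)}\bigl(h_2(\phi)-h_1(\phi)\bigr)$. Then $$H^\star=\inf\Bigl\{\lambda\in\mathbb{R}:\ \exists\,\varphi\in C^2(\mathbb{T}^n)\ (\varphi\in C^1(\mathbb{T}^n)\text{ if }\sigma=0)\ \text{ with } -\frac{\sigma^2}{2}\Delta\varphi+H(D_x\varphi,x)<\lambda \ \text{ for all } x\in\mathbb{T}^n\Bigr\},$$ where $H(p,x)=\sup_{v\in\mathbb{R}^n}\bigl(-p\cdot v-L(x,v)\bigr)$.
   Context: Fix $\sigma\ge 0$. Let $\mathbb{T}^n=\mathbb{R}^n/\mathbb{Z}^n$ and $\Omega=\mathbb{T}^n\times\mathbb{R}^n$, with points $(x,v)$. The Lagrangian $L(x,v)$ is smooth in both variables, $\mathbb{Z}^n$-periodic in $x$, coercive and strictly convex in $v$, and $L\ge 0$. Fix a function $\gamma=\gamma(|v|):\Omega\to[1,+\infty)$ with $L(x,v)/\gamma(v)\to+\infty$ and $|v|/\gamma(v)\to 0$ as $|v|\to+\infty$. $C^0_\gamma(\Omega)$ is the space of continuous functions $\phi$ on $\Omega$ with $\|\phi\|_\gamma=\sup_\Omega|\phi/\gamma|<\infty$ and $\phi(x,v)/\gamma(v)\to 0$ as $|v|\to\infty$. For $\phi\in C^0_\gamma(\Omega)$ define $h_1(\phi)=\sup_{(x,v)\in\Omega}(-\phi(x,v)-L(x,v))$. With $A^v\varphi=\frac{\sigma^2}{2}\Delta\varphi+v\cdot\nabla\varphi$, let $\mathcal{C}$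 be the closure in $C^0_\gamma(\Omega)$ of $\{A^v\varphi:\varphi\in C^2(\mathbb{T}^n)\}$ (if $\sigma=0$ one may take $\varphi\in C^1(\mathbb{T}^n)$). Define $h_2(\phi)=0$ if $\phi\in\mathcal{C}$ and $h_2(\phi)=-\infty$ otherwise. *)

(* Defs.v *)
From HB Require Import structures.
From mathcomp Require Import all_boot all_order all_algebra.
From mathcomp Require Import all_classical all_reals all_analysis.

Set Implicit Arguments.
Unset Strict Implicit.
Unset Printing Implicit Defensive.

Import Order.TTheory GRing.Theory Num.Theory.
Import numFieldNormedType.Exports.

Local Open Scope classical_set_scope.
Local Open Scope ring_scope.

Section Defs.
Context {R : realType} {n : nat}.

(* Functions on the torus T^n = R^n / Z^n are Z^n-periodic functions on R^n,
   and functions on Omega = T^n x R^n are functions on R^n x R^n that are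
   Z^n-periodic in the first component. *)
Notation Omega := ('rV[R]_n * 'rV[R]_n)%type.

Definition Zperiodic (f : 'rV[R]_n -> R) : Prop :=
  forall (x : 'rV[R]_n) (m : 'rV[int]_n),
    f (x + map_mx (intr : int -> R) m) = f x.

Definition Zperiodic_x (f : Omega -> R) : Prop :=
  forall v : 'rV[R]_n, Zperiodic (fun x => f (x, v)).

Definition dot (u v : 'rV[R]_n) : R := \sum_(i < n) u 0 i * v 0 i.

(* The library norm on 'rV[R]_n is the sup norm; |v| is the Euclidean one. *)
Definition enorm (v : 'rV[R]_n) : R := Num.sqrt (dot v v).

(* The filter "|v| -> +oo" on Omega; limits along it are uniform in x. *)
Definition vinfty : set_system Omega :=
  filter_from setT (fun K : R => [set z : Omega | K < enorm z.2]).

Global Instance vinfty_filter : Filter vinfty.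
Proof.
apply: filter_from_filter; first by exists 0.
move=> a b _ _; exists (Num.max a b) => // z /=.
by rewrite gt_max => /andP[].
Qed.

(* C^k on a finite-dimensional space: continuity for k = 0, and otherwise
   differentiability everywhere with all directional derivatives C^(k-1). *)
Fixpoint Ck (V : normedModType R) (k : nat) (f : V -> R) : Prop :=
  match k with
  | 0%N => continuous f
  | k'.+1 => (forall x, differentiable f x) /\ (forall v, Ck k' ('D_v f))
  end.

Definition smooth (V : normedModType R) (f : V -> R) : Prop :=
  forall k, Ck k f.

Definition CkT (k : nat) : set ('rV[R]_n -> R) :=
  [set phi | Ck k phi /\ Zperiodic phi].

Definition strictly_convex (f : 'rV[R]_n -> R) : Prop :=
  forall (u v : 'rV[R]_n) (t : R), u != v -> 0 < t -> t < 1 ->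
    f (t *: u + (1 - t) *: v) < t * f u + (1 - t) * f v.

Definition grad (phi : 'rV[R]_n -> R) (x : 'rV[R]_n) : 'rV[R]_n :=
  \row_(i < n) 'D_('e_i) phi x.

Definition laplacian (phi : 'rV[R]_n -> R) (x : 'rV[R]_n) : R :=
  \sum_(i < n) 'D_('e_i) ('D_('e_i) phi) x.

Definition gnorm (gamma : R -> R) (phi : Omega -> R) : \bar R :=
  ereal_sup [set (`|phi z / gamma (enorm z.2)|)%:E | z in [set: Omega]].

Definition C0gamma (gamma : R -> R) : set (Omega -> R) :=
  [set phi | [/\ continuous phi, Zperiodic_x phi, (gnorm gamma phi < +oo)%E &
     phi z / gamma (enorm z.2) @[z --> vinfty] --> (0 : R)]].

(* When sigma = 0 and varphi is only C^1, the (then meaningless) Laplacian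
   is multiplied by 0. *)
Definition genA (sigma : R) (varphi : 'rV[R]_n -> R) : Omega -> R :=
  fun z => sigma ^+ 2 / 2 * laplacian varphi z.1 + dot z.2 (grad varphi z.1).

Definition Cclosure (sigma : R) (gamma : R -> R) (k : nat) :
    set (Omega -> R) :=
  [set phi | C0gamma gamma phi /\
     forall eps : R, 0 < eps -> exists2 varphi, CkT k varphi &
       (gnorm gamma (fun z => phi z - genA sigma varphi z)%R < eps%:E)%E].

Definition h1 (L : Omega -> R) (phi : Omega -> R) : \bar R :=
  ereal_sup [set (- phi z - L z)%:E | z in [set: Omega]].

Definition h2 (sigma : R) (gamma : R -> R) (k : nat) (phi : Omega -> R) :
    \bar R :=
  if phi \in Cclosure sigma gamma k then 0%E else -oo%E.

Definition Hstar (sigma : R) (L : Omega -> R) (gamma : R -> R) (k : nat) :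
    \bar R :=
  (- ereal_sup [set h2 sigma gamma k phi - h1 L phi | phi in C0gamma gamma])%E.

Definition hamiltonian (L : Omega -> R) (p x : 'rV[R]_n) : \bar R :=
  ereal_sup [set (- dot p v - L (x, v))%:E | v in [set: 'rV[R]_n]].

End Defs.

(* Main.v *)
(* Since h_2 vanishes on the closure of the range of A^v and is -oo elsewhere,
   H* is the infimum over that closure of sup (-phi - L), and for
   phi = A^v varphi this supremum is the supremum over x of
   -sigma^2/2 Laplacian(varphi) + H(D varphi, x).  Two approximations remain.
   (1) The supremum at phi in the closure is almost attained along A^v varphi
   with A^v varphi close to phi: for large |v| the growth of L / gamma
   dominates.  For |v| <= K no bound on gamma is available (gamma is not
   assumed locally bounded), but phi - A^v varphi is affine in v, hence bounded
   by its values on the sphere |v| = K, where gamma is a constant.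
   (2) If sigma = 0 and the closure is taken over C^2 functions, a C^1 function
   must be approximated by C^2 ones uniformly with its gradient; this is done
   by averaging once along each coordinate direction (Steklov averages). *)
Require Import Defs.
From HB Require Import structures.
From mathcomp Require Import all_boot all_order all_algebra.
From mathcomp Require Import all_classical all_reals all_analysis.
From mathcomp Require Import ring lra.
Import Order.TTheory GRing.Theory Num.Theory.
Import numFieldNormedType.Exports.
Local Open Scope classical_set_scope.
Local Open Scope ring_scope.

(** * Compactness for periodic functions *)

Section Periodic.
Context {R : realType} {n : nat}.
Implicit Types (f : 'rV[R]_n -> R) (x y u v : 'rV[R]_n).

Lemma unit_cube_compact :
  compact [set x : 'rV[R]_n | forall i, `[0, 1]%classic (x ord0 i)].
Proof.
apply: (@rV_compact R n (fun=> `[0, 1]%classic)) => _; exact: segment_compact.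
Qed.

Lemma unit_cube_repr x : exists m : 'rV[int]_n,
  forall i, `[0, 1]%classic ((x + map_mx (intr : int -> R) m) ord0 i).
Proof.
exists (\row_i - Num.floor (x ord0 i)) => i.
rewrite !mxE rmorphN /= in_itv /= subr_ge0 Num.Theory.floor_le //=.
by rewrite lerBlDr addrC -[1]/(1%:~R) -intrD ltW // Num.Theory.floorD1_gt.
Qed.

(** Near each [x] the bound [|f x| + 1] works. Compactness of the unit cube, in near-covering form,
    gives one [M] for the cube, and integer translations carry it to the whole space. *)
Lemma periodic_bounded f : continuous f -> Zperiodic f ->
  exists2 M, 0 <= M & forall x, `|f x| <= M.
Proof.
move=> cf pf.
have : near_covering [set x : 'rV[R]_n | forall i, `[0, 1]%classic (x ord0 i)].
  exact/compact_near_coveringP/unit_cube_compact.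
move=> /(_ R (+oo%R : set_system R) (fun M x => `|f x| <= M)) [].
  move=> x _; exists ([set y | `|f x - f y| < 1], [set M | `|f x| + 1 < M]) => /=.
    split; last exact: nbhs_pinfty_gt.
    by have /cvgrPdist_lt /(_ _ ltr01) := cf x.
  move=> [y M] /= [fy /ltW]; apply: le_trans.
  rewrite -lerBlDl (le_trans (lerB_dist _ _)) // distrC; exact: ltW.
move=> N [_ HN]; exists (Num.max 0 N + 1).
  by rewrite addr_ge0 // le_max lexx.
move=> x; have [m Hm] := unit_cube_repr x.
rewrite -(pf x m); apply: HN Hm.
by rewrite (@le_lt_trans _ _ (Num.max 0 N)) ?ltrDl // le_max lexx orbT.
Qed.

(** Compactness is used for [x] only: [y] ranges over the whole space, so translating both points by
    the integer vector that brings [x] into the cube is enough. *)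
Lemma periodic_unif f : continuous f -> Zperiodic f ->
  forall e : R, 0 < e -> exists2 d, 0 < d &
    forall x y, `|y - x| < d -> `|f y - f x| <= e.
Proof.
move=> cf pf e e0.
have : near_covering [set x : 'rV[R]_n | forall i, `[0, 1]%classic (x ord0 i)].
  exact/compact_near_coveringP/unit_cube_compact.
move=> /(_ R (0^'+) (fun d x => forall y, `|y - x| < d -> `|f y - f x| <= e)) [].
  move=> x _; have /cvgrPdist_lt /(_ (e / 2)) := cf x.
  rewrite divr_gt0 // => /(_ isT) /nbhs_ballP [r /= r0 Hr].
  exists (ball x (r / 2), [set d | d < r / 2]) => /=.
    split; first by apply: nbhsx_ballx; rewrite divr_gt0.
    by apply: nbhs_right_lt; rewrite divr_gt0.
  move=> [x' d] /= [xx' dr] y yx'.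
  have rr : r / 2 < r by rewrite ltr_pdivrMr // ltr_pMr // ltrDl.
  have fx' : `|f x - f x'| < e / 2 by apply: Hr; apply: le_ball xx'; exact: ltW.
  have fy : `|f x - f y| < e / 2.
    apply: Hr; rewrite -ball_normE /= (splitr r) -(subrKA x').
    rewrite (le_lt_trans (ler_normD _ _)) // ltrD //.
      by move: xx'; rewrite -ball_normE.
    by rewrite distrC (lt_trans yx').
  rewrite (_ : f y - f x' = (f x - f x') - (f x - f y)); last by ring.
  by rewrite (le_trans (ler_normB _ _)) // [leRHS]splitr lerD // ltW.
move=> d /= d0 Hd; exists (d / 2); first by rewrite divr_gt0.
move=> x y xy; have [m Hm] := unit_cube_repr x.
rewrite -(pf x m) -(pf y m); apply: (Hd (d / 2) _ _ _ Hm).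
- by rewrite /= sub0r normrN gtr0_norm ?divr_gt0 //; lra.
- by rewrite divr_gt0.
- by rewrite opprD addrACA subrr addr0.
Qed.

End Periodic.

(** * Directional derivatives and mean value estimates *)

Section Lines.
Context {R : realType}.

(** Quotient-free form of the derivative: the remainder is linear in [f] and [c], so it can later be
    averaged. *)
Lemma is_derive_eps (V : normedModType R) (f : V -> R) (x v : V) (c : R) :
  (forall e : R, 0 < e -> exists2 d, 0 < d & forall s : R, `|s| < d ->
     `|f (x + s *: v) - f x - s * c| <= e * `|s|) ->
  is_derive x v f c.
Proof.
move=> H.
have lim_c : (fun h => h^-1 *: ((f \o shift x) (h *: v) - f x)) @ 0^' --> c.
  apply/cvgrPdist_le => e e0; have [d d0 Hd] := H _ e0.
  exists d => // s /=; rewrite sub0r normrN => sd s0.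
  have s0' : 0 < `|s| by rewrite normr_gt0.
  rewrite -(ler_pM2r s0') -normrM.
  rewrite (_ : _ * s = - (f (x + s *: v) - f x - s * c)) ?normrN; first exact: Hd.
  by rewrite -[s^-1 *: _]/(s^-1 * _) (addrC _ x); field; exact: s0.
split; first by apply/cvg_ex; exists c.
exact/cvg_lim.
Qed.

Lemma is_derive_line (V : normedModType R) (f : V -> R) (x v : V) (t : R) :
  derivable f (x + t *: v) v ->
  is_derive t 1 (fun s => f (x + s *: v)) ('D_v f (x + t *: v)).
Proof.
move=> df; rewrite /derive.
have E : (fun h : R => h^-1 *: (((fun s => f (x + s *: v)) \o shift t) (h *: 1)
             - f (x + t *: v)))
       = (fun h => h^-1 *: ((f \o shift (x + t *: v)) (h *: v) - f (x + t *: v))).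
  apply/funext => h /=; congr (_ *: (f _ - _)).
  by rewrite [h *: 1]mulr1 scalerDl addrCA.
split; first by rewrite /derivable E.
by rewrite /derive E.
Qed.

Lemma mvt_le (F dF : R -> R) (a b c e : R) : a <= b ->
  (forall t, a <= t <= b -> is_derive t 1 F (dF t)) ->
  (forall t, a <= t <= b -> `|dF t - c| <= e) ->
  `|F b - F a - (b - a) * c| <= e * (b - a).
Proof.
move=> ab dFP dFc.
have [||t tab ->] := @MVT_segment R F dF a b ab.
- by move=> t; rewrite in_itv /= => /andP[at' tb]; apply: dFP; rewrite !ltW.
- apply: derivable_within_continuous => t; rewrite in_itv /= => tab.
  by have [] := dFP t tab.
rewrite mulrC -mulrBr normrM ger0_norm ?subr_ge0 // mulrC.
by rewrite ler_wpM2r ?subr_ge0 // dFc // -in_itv.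
Qed.

Lemma mvt_line_le (V : normedModType R) (f : V -> R) (x v : V) (s c e : R) :
  (forall y, derivable f y v) ->
  (forall t : R, `|t| <= `|s| -> `|'D_v f (x + t *: v) - c| <= e) ->
  `|f (x + s *: v) - f x - s * c| <= e * `|s|.
Proof.
move=> df Hc.
pose F (t : R) := f (x + t *: v).
have dF (t : R) : is_derive t 1 F ('D_v f (x + t *: v)) by exact: is_derive_line.
have F0 : F 0 = f x by rewrite /F scale0r addr0.
rewrite -F0; have [s0|s0] := leP 0 s.
  have := @mvt_le F _ 0 s c e s0 (fun t _ => dF t).
  rewrite subr0 (ger0_norm s0); apply => t /andP[t0 ts].
  by apply: Hc; rewrite !ger0_norm.
have := @mvt_le F _ s 0 c e (ltW s0) (fun t _ => dF t).
rewrite sub0r (ltr0_norm s0) => H.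
(* For [s < 0] the estimate is taken on [[s, 0]], which reverses the sign of the increment. *)
rewrite -normrN (_ : - (_ - _ - _) = F 0 - F s - - s * c); last first.
  by rewrite -/(F s); ring.
apply: H => t /andP[st t0].
by apply: Hc; rewrite ler0_norm // (ltr0_norm s0) lerN2.
Qed.

End Lines.

(** * Continuous partial derivatives imply differentiability *)

Section Partials.
Context {R : realType} {n : nat}.
Implicit Types (f : 'rV[R]_n -> R) (x y u v : 'rV[R]_n).

Lemma continuous_sumr (T : topologicalType) (I : finType) (F : I -> T -> R) :
  (forall i, continuous (F i)) -> continuous (fun z => \sum_i F i z).
Proof.
by move=> cF z; apply: cvg_big => [|i _]; [exact: add_continuous|exact: cF].
Qed.

Lemma differentiable_eps (V W : normedModType R) (f : V -> W)
    (L : {linear V -> W}) (x : V) : continuous L ->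
  (forall e : R, 0 < e ->
     \forall u \near 0, `|f (x + u) - f x - L u| <= e * `|u|) ->
  differentiable f x.
Proof.
move=> cL fL.
have fLo : f \o shift x = cst (f x) + L +o_ 0 id.
  apply/eqaddoP => e e0; apply: filterS (fL _ e0) => u.
  by rewrite -addrA -opprD (addrC x).
by apply/diff_locallyP; rewrite (diff_unique cL fLo).
Qed.

Lemma norm_delta_le1 (i : 'I_n) : `|'e_i : 'rV[R]_n| <= 1.
Proof.
rewrite /Num.norm /= mx_normrE; apply: bigmax_le => // -[j k] _.
by rewrite mxE; case: (_ && _); rewrite ?normr1 ?normr0.
Qed.

Lemma norm_coord_le u (i : 'I_n) : `|u 0 i| <= `|u|.
Proof.
rewrite [`|u|]/Num.norm /= mx_normrE.
exact: (@le_bigmax _ _ _ 0 (fun ij => `|u ij.1 ij.2|) (0, i)).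
Qed.

Lemma derive_sum_partials f x v : differentiable f x ->
  'D_v f x = \sum_(i < n) v 0 i * 'D_('e_i) f x.
Proof.
move=> df; rewrite deriveE // [in LHS](row_sum_delta v) linear_sum.
by apply: eq_bigr => i _; rewrite linearZ deriveE.
Qed.

(** The increment is split into moves along one coordinate at a time, [y] being the current corner.
    The budget [d] keeps every corner in the ball around [x] where the partials vary by at most [e],
    so the mean value estimate applies to each move. *)
Lemma partials_increment f x e d (s : seq 'I_n) u y :
  (forall i z, derivable f z 'e_i) ->
  (forall i z, `|z - x| < d -> `|'D_('e_i) f z - 'D_('e_i) f x| <= e) ->
  `|y - x| + \sum_(i <- s) `|u 0 i| < d ->
  `|f (y + \sum_(i <- s) u 0 i *: 'e_i) - f y
     - \sum_(i <- s) u 0 i * 'D_('e_i) f x|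
  <= e * \sum_(i <- s) `|u 0 i|.
Proof.
move=> df He; elim: s y => [|i s IH] y.
  by move=> _; rewrite !big_nil addr0 subr0 subrr normr0 mulr0.
rewrite !big_cons addrA => yd.
have e_le t : `|t *: ('e_i : 'rV[R]_n)| <= `|t|.
  by rewrite normrZ ler_piMr // norm_delta_le1.
have step : `|f (y + u 0 i *: 'e_i) - f y - u 0 i * 'D_('e_i) f x|
             <= e * `|u 0 i|.
  apply: mvt_line_le => // t ti; apply: He; apply: le_lt_trans yd.
  rewrite [y + _ - x]addrAC (le_trans (ler_normD _ _)) // -[leRHS]addrA lerD2l.
  by rewrite (le_trans (e_le t)) // (le_trans ti) // lerDl sumr_ge0.
have IHy : `|y + u 0 i *: 'e_i - x| + \sum_(j <- s) `|u 0 j| < d.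
  apply: le_lt_trans yd; rewrite lerD2r [y + _ - x]addrAC.
  by rewrite (le_trans (ler_normD _ _)) // lerD2l e_le.
move: (IH _ IHy); rewrite mulrDr => {}IHy.
rewrite (_ : _ - _ - _ =
  (f (y + u 0 i *: 'e_i) - f y - u 0 i * 'D_('e_i) f x) +
  (f (y + u 0 i *: 'e_i + \sum_(j <- s) u 0 j *: 'e_j) -
     f (y + u 0 i *: 'e_i) - \sum_(j <- s) u 0 j * 'D_('e_j) f x)).
  by rewrite (le_trans (ler_normD _ _)) // lerD.
by rewrite addrA; ring.
Qed.

Lemma differentiable_partials f :
  (forall i x, derivable f x 'e_i) ->
  (forall i, continuous ('D_('e_i) f)) ->
  forall x, differentiable f x.
Proof.
move=> df cf x.
pose l u : R := \sum_(i < n) u 0 i * 'D_('e_i) f x.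
have l_lin : linear l.
  move=> a u v; rewrite /l scaler_sumr -big_split /=; apply: eq_bigr => i _.
  by rewrite !mxE mulrDl -mulrA.
pose lL := GRing.isLinear.Build R 'rV[R]_n R _ l l_lin.
pose L : {linear 'rV[R]_n -> R} := HB.pack l lL.
have cL : continuous L.
  have cF (i : 'I_n) (u : 'rV[R]_n) :
      {for u, continuous (fun w : 'rV[R]_n => w 0 i * 'D_('e_i) f x)}.
    by apply: continuousM; [exact: coord_continuous|exact: cst_continuous].
  exact: continuous_sumr.
apply: (@differentiable_eps 'rV[R]_n R f L x cL) => e e0.
  (* The coordinates of [u] sum in absolute value to at most [n.+1 * |u|]; [n.+1] also avoids a zero
     denominator when [n = 0]. *)
  pose e' := e / (n.+1%:R).
  have e'0 : 0 < e' by rewrite divr_gt0.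
  have : \forall z \near x, forall i : 'I_n, `|'D_('e_i) f z - 'D_('e_i) f x| <= e'.
    apply: (@filter_forall _ _ (fun (i : 'I_n) z =>
      `|'D_('e_i) f z - 'D_('e_i) f x| <= e') (nbhs x) _) => i.
    have /cvgrPdist_le /(_ _ e'0) := cf i x.
    by apply: filterS => z; rewrite distrC.
  move=> /nbhs_ballP [d /= d0 Hd].
  near=> u.
  have sum_u : \sum_(i <- enum 'I_n) `|u 0 i| <= n.+1%:R * `|u|.
    rewrite big_enum /= (le_trans (ler_sum _ (fun i _ => norm_coord_le u i))) //.
    by rewrite sumr_const card_ord -[leLHS]mulr_natl ler_wpM2r // ler_nat.
  have ud : `|x - x| + \sum_(i <- enum 'I_n) `|u 0 i| < d.
    rewrite subrr normr0 add0r (le_lt_trans sum_u) // mulrC -ltr_pdivlMr //.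
    near: u; apply/nbhs_ballP; exists (d / n.+1%:R); first by rewrite /= divr_gt0.
    by move=> u; rewrite -ball_normE /= sub0r normrN.
  have De (i : 'I_n) z : `|z - x| < d -> `|'D_('e_i) f z - 'D_('e_i) f x| <= e'.
    by move=> zx; apply: Hd; rewrite -ball_normE /= distrC.
  have := @partials_increment f x e' d (enum 'I_n) u x df De ud.
  rewrite [in X in f X]big_enum [in X in _ - X]big_enum /= -(row_sum_delta u).
  move=> /le_trans; apply.
  rewrite (le_trans (ler_wpM2l (ltW e'0) sum_u)) // /e' mulrA divfK //.
Unshelve. all: by end_near. Qed.

End Partials.

(** * Primitives and means of continuous functions of one variable *)

Section Steklov.
Context {R : realType}.

Lemma is_derive_eps_sub (V : normedModType R) (f : V -> R) (x v : V) (c : R) :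
  is_derive x v f c ->
  forall e : R, 0 < e -> exists2 d, 0 < d & forall s : R, `|s| < d ->
     `|f (x + s *: v) - f x - s * c| <= e * `|s|.
Proof.
move=> [df <-] e e0.
have /eqaddoP/(_ _ e0) := derivable_nbhs df.
move=> /nbhs_ballP [d /= d0 Hd]; exists d => // s sd.
have := Hd s; rewrite /ball /= sub0r normrN => /(_ sd).
by rewrite opprD addrA (addrC x).
Qed.

Lemma continuous_primitive (g : R -> R) (a b : R) : continuous g ->
  exists G : R -> R, forall t, a < t < b -> is_derive t 1 G (g t).
Proof.
move=> cg; exists (fun x => (\int[lebesgue_measure]_(t in `[a, x]) g t)%R).
move=> t /andP[at_ tb].
have int_g : lebesgue_measure.-integrable `[a, b] (EFin \o g).
  apply: continuous_compact_integrable; first exact: segment_compact.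
  exact: continuous_subspaceT.
have [dG G't] := continuous_FTC1_closed tb int_g at_ (cg t).
by split; [exact: dG|rewrite -derive1E].
Qed.

(** An arbitrary choice among the antiderivatives on the open interval; [meanE] shows that the mean
    does not depend on it. *)
Definition primitive (a b : R) (g : R -> R) : R -> R :=
  get (fun G : R -> R => forall t, a < t < b -> is_derive t 1 G (g t)).

(* The mean (1/h) int_0^h g.  The primitive lives on an interval larger than
   [0, h], so that it is differentiable at both end points. *)
Definition mean (h : R) (g : R -> R) : R :=
  (primitive (-1) (h + 1) g h - primitive (-1) (h + 1) g 0) / h.

Lemma primitiveP (a b : R) (g : R -> R) : continuous g ->
  forall t, a < t < b -> is_derive t 1 (primitive a b g) (g t).
Proof. by move=> /(@continuous_primitive g a b) /getPex. Qed.

(** Two antiderivatives of [g] differ by a function of zero derivative, and [mvt_le] with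
    [c = e = 0] makes that difference constant. *)
Lemma meanE (h : R) (g G : R -> R) : 0 < h -> continuous g ->
  (forall t, 0 <= t <= h -> is_derive t 1 G (g t)) ->
  mean h g = (G h - G 0) / h.
Proof.
move=> h0 cg dG; congr (_ / _); apply/eqP; rewrite -subr_eq0 -normr_le0.
have := @mvt_le R (primitive (-1) (h + 1) g - G) (cst 0) 0 h 0 0 (ltW h0).
rewrite mulr0 subr0 mul0r (_ : (_ - G) h - _ =
 primitive (-1) (h + 1) g h - primitive (-1) (h + 1) g 0 - (G h - G 0)).
  apply.
    move=> t /andP[t0 th]; rewrite /cst -(subrr (g t)); apply: is_deriveB.
      by apply: primitiveP => //; apply/andP; split; lra.
    by apply: dG; rewrite t0.
  by move=> t _; rewrite subrr normr0.
by rewrite -![(_ - G) _]/(_ _ - G _); ring.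
Qed.

Lemma meanD (h a : R) (f g : R -> R) : 0 < h -> continuous f -> continuous g ->
  mean h (fun t => f t + a * g t) = mean h f + a * mean h g.
Proof.
move=> h0 cf cg.
pose F := primitive (-1) (h + 1) f; pose G := primitive (-1) (h + 1) g.
have cfg : continuous (fun t => f t + a * g t).
  by move=> t; apply: cvgD; [exact: cf|apply: cvgM; [exact: cvg_cst|exact: cg]].
have dFG t : 0 <= t <= h -> is_derive t (1 : R) (F + a *: G) (f t + a * g t).
  move=> th; have t_in : -1 < t < h + 1 by move: th; lra.
  have dF := primitiveP _ _ _ cf _ t_in; have dG := primitiveP _ _ _ cg _ t_in.
  exact: (is_deriveD dF (is_deriveZ a dG)).
have FGE t : (F + a *: G) t = F t + a * G t by [].
rewrite (meanE _ _ _ h0 cfg dFG) !FGE /mean -/F -/G.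
by field; rewrite gt_eqF.
Qed.

Lemma mean_le (h c e : R) (g : R -> R) : 0 < h -> continuous g ->
  (forall t, 0 <= t <= h -> `|g t - c| <= e) -> `|mean h g - c| <= e.
Proof.
move=> h0 cg gc.
have := @mvt_le R (primitive (-1) (h + 1) g) g 0 h c e (ltW h0) _ gc.
rewrite subr0 /mean => /(_ _) H.
rewrite -(ler_pM2r h0) -[X in _ * X <= _](gtr0_norm h0) -normrM.
rewrite mulrBl divfK ?gt_eqF // (mulrC c); apply: H => t th.
by apply: primitiveP => //; move: th; lra.
Qed.

End Steklov.

(** * Averaging along one coordinate direction *)

Section SteklovAverage.
Context {R : realType} {n : nat}.
Implicit Types (f : 'rV[R]_n -> R) (x y u v : 'rV[R]_n).

Definition continuous_periodic f := continuous f /\ Zperiodic f.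

Definition steklov (h : R) (i : 'I_n) f x : R :=
  mean h (fun t => f (x + t *: 'e_i)).

Lemma continuous_modulus (V : normedModType R) (f : V -> R) :
  (forall e : R, 0 < e -> exists2 d, 0 < d &
     forall x y : V, `|y - x| < d -> `|f y - f x| <= e) -> continuous f.
Proof.
move=> fe x; apply/cvgrPdist_le => e e0; have [d d0 fd] := fe e e0.
apply/nbhs_ballP; exists d => //= y; rewrite -ball_normE /= => xy.
exact: fd.
Qed.

Lemma continuous_line f x v : continuous f ->
  continuous (fun t : R => f (x + t *: v)).
Proof.
move=> cf t; apply: (@continuous_comp _ _ _ (fun t : R => x + t *: v) f).
  by apply: cvgD; [exact: cvg_cst|apply: cvgZr_tmp; exact: cvg_id].
exact: cf.
Qed.

Lemma mean_sub_le (h e : R) (f g : R -> R) : 0 < h ->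
  continuous f -> continuous g ->
  (forall t, 0 <= t <= h -> `|f t - g t| <= e) -> `|mean h f - mean h g| <= e.
Proof.
move=> h0 cf cg fg.
rewrite (_ : _ - _ = mean h (fun t => f t + (-1) * g t) - 0); last first.
  by rewrite meanD // mulN1r subr0.
apply: mean_le => //.
  by move=> t; apply: cvgD; [exact: cf|apply: cvgM; [exact: cvg_cst|exact: cg]].
by move=> t /fg; rewrite mulN1r subr0.
Qed.

(** Averaging preserves a modulus of continuity, so the same [d] and [e] serve at every stage of an
    iterated average. *)
Lemma steklov_modulus h i f d e : 0 < h -> continuous f ->
  (forall x y, `|y - x| < d -> `|f y - f x| <= e) ->
  forall x y, `|y - x| < d -> `|steklov h i f y - steklov h i f x| <= e.
Proof.
move=> h0 cf fe x y xy; apply: mean_sub_le => //; try exact: continuous_line.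
by move=> t _; apply: fe; rewrite opprD addrACA subrr addr0.
Qed.

Lemma steklov_close h i f d e : 0 < h < d -> continuous f ->
  (forall x y, `|y - x| < d -> `|f y - f x| <= e) ->
  forall x, `|steklov h i f x - f x| <= e.
Proof.
move=> /andP[h0 hd] cf fe x; apply: mean_le => //; first exact: continuous_line.
move=> t /andP[t0 th]; apply: fe; rewrite addrAC subrr add0r normrZ ger0_norm //.
by rewrite (le_lt_trans _ hd) // (le_trans _ th) // ler_piMr // norm_delta_le1.
Qed.

Lemma continuous_periodic_steklov h i f : 0 < h ->
  continuous_periodic f -> continuous_periodic (steklov h i f).
Proof.
move=> h0 [cf pf]; split; last first.
  by move=> x m; congr mean; apply/funext => t; rewrite addrAC pf.
apply: continuous_modulus => e e0.
have [d d0 fd] := periodic_unif _ cf pf _ e0; exists d => //.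
exact: steklov_modulus.
Qed.

(** Differentiation under the mean: by linearity the remainder of the average is the average of the
    remainders, and uniform continuity of the partial derivative bounds these uniformly in [t]. *)
Lemma is_derive_steklov h i j f : 0 < h -> continuous f ->
  (forall x, derivable f x 'e_j) -> continuous_periodic ('D_('e_j) f) ->
  forall x, is_derive x 'e_j (steklov h i f) (steklov h i ('D_('e_j) f) x).
Proof.
move=> h0 cf df [cDf pDf] x; apply: is_derive_eps => e e0.
have [d d0 Dfd] := periodic_unif _ cDf pDf _ e0; exists d => // s sd.
have cDl := continuous_line _ x 'e_i cDf.
have cl (g : 'rV[R]_n -> R) (z : 'rV[R]_n) : continuous g ->
  continuous (fun t : R => g (z + t *: 'e_i)) by exact: continuous_line.
rewrite (_ : _ - _ = mean h (fun t => (f (x + s *: 'e_j + t *: 'e_i) +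
  -1 * f (x + t *: 'e_i)) + - s * 'D_('e_j) f (x + t *: 'e_i)) - 0); last first.
  rewrite !meanD // ?subr0 ?mulN1r ?mulNr //; try exact: cl.
  move=> t; apply: cvgD; first exact: (cl f).
  by apply: cvgM; [exact: cvg_cst|exact: (cl f)].
apply: mean_le => //.
  move=> t; apply: cvgD; last by apply: cvgM; [exact: cvg_cst|exact: cDl].
  apply: cvgD; first exact: (cl f).
  by apply: cvgM; [exact: cvg_cst|exact: (cl f)].
move=> t _; rewrite subr0 mulN1r mulNr [x + s *: _ + _]addrAC.
apply: mvt_line_le => // r rs; apply: Dfd; rewrite addrAC subrr add0r normrZ.
by rewrite (le_lt_trans _ sd) // (le_trans _ rs) // ler_piMr // norm_delta_le1.
Qed.

(** Along its own direction the average is [(G (s + h) - G s) / h] for a primitive [G], so averaging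
    a continuous function gains one derivative there. *)
Lemma is_derive_steklov_self (h : R) i f : 0 < h -> continuous f ->
  forall x, is_derive x 'e_i (steklov h i f) ((f (x + h *: 'e_i) - f x) / h).
Proof.
move=> h0 cf x; apply: is_derive_eps => e e0.
pose g (t : R) := f (x + t *: 'e_i).
have cg : continuous g by exact: continuous_line.
pose G := primitive (-1) (h + 1) g.
have dG (t : R) : -1 < t < h + 1 -> is_derive t (1 : R) G (g t).
  exact: primitiveP.
have dGh : is_derive h (1 : R) G (g h) by apply: dG; lra.
have dG0 : is_derive 0 (1 : R) G (g 0) by apply: dG; lra.
(* The errors at the two end points add up, and the sum is divided by [h]. *)
have e'0 : 0 < e * h / 2 by rewrite divr_gt0 ?mulr_gt0.
have [d1 d10 Gh] := is_derive_eps_sub _ _ _ _ _ dGh _ e'0.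
have [d2 d20 G0] := is_derive_eps_sub _ _ _ _ _ dG0 _ e'0.
(* The bound 1 keeps [s + t] inside []-1, h + 1[], where [G] is known to be differentiable. *)
exists (Num.min 1 (Num.min d1 d2)); first by rewrite !lt_min ltr01 d10.
move=> s; rewrite !lt_min => /and3P[s1 sd1 sd2].
have dGs (t : R) : 0 <= t <= h ->
    is_derive t (1 : R) (fun r => G (s + r)) (g (s + t)).
  move=> th; have ts : -1 < s + t < h + 1.
    by move: th s1; rewrite ltr_norml; lra.
  have [dGts Dg] := dG _ ts.
  have := @is_derive_line R R G s 1 t; rewrite [t *: 1]mulr1 Dg => /(_ dGts).
  by under [fun r => G (s + r *: 1)]eq_fun do rewrite [_ *: 1]mulr1.
have sE : steklov h i f (x + s *: 'e_i) = (G (s + h) - G s) / h.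
  rewrite /steklov (_ : (fun t => _) = (fun t => g (s + t))); last first.
    by apply/funext => t; rewrite /g scalerDl addrA.
  rewrite (meanE _ _ _ h0 _ dGs) ?addr0 // => t.
  apply: (@continuous_comp _ _ _ (fun r => s + r) g); last exact: cg.
  by apply: cvgD; [exact: cvg_cst|exact: cvg_id].
have s0E : steklov h i f x = (G h - G 0) / h by [].
rewrite sE s0E.
have := Gh s sd1; have := G0 s sd2; rewrite add0r [s *: 1]mulr1 (addrC h).
move=> H0 Hh.
rewrite (_ : _ - _ = ((G (s + h) - G h - s * g h) - (G s - G 0 - s * g 0)) / h).
  rewrite normrM normfV (gtr0_norm h0) ler_pdivrMr //.
  rewrite (le_trans (ler_normB _ _)) // (le_trans (lerD Hh H0)) //.
  by rewrite le_eqVlt; apply/orP; left; apply/eqP; field.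
rewrite /g scale0r addr0; field; exact: lt0r_neq0.
Qed.

End SteklovAverage.

(** * Iterated averages along a list of directions *)

Section Smoothing.
Context {R : realType} {n : nat}.
Implicit Types (f : 'rV[R]_n -> R) (x y u v : 'rV[R]_n).

Definition steklov_iter (h : R) (s : seq 'I_n) f := foldr (steklov h) f s.

Lemma continuous_periodic_steklov_iter h s f : 0 < h ->
  continuous_periodic f -> continuous_periodic (steklov_iter h s f).
Proof.
by move=> h0 cf; elim: s => [//|i s]; exact: continuous_periodic_steklov.
Qed.

(** Each average moves the function by at most [e], since every partial iterate keeps the modulus of
    [f]; the triangle inequality adds these up. *)
Lemma steklov_iter_close h s f d e : 0 < h < d -> continuous_periodic f ->
  (forall x y, `|y - x| < d -> `|f y - f x| <= e) ->
  forall x, `|steklov_iter h s f x - f x| <= (size s)%:R * e.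
Proof.
move=> hd cf fe; have [h0 _] := andP hd.
have cs r := (continuous_periodic_steklov_iter h r f h0 cf).1.
have modulus r x y : `|y - x| < d ->
    `|steklov_iter h r f y - steklov_iter h r f x| <= e.
  elim: r x y => [|i r IH] x y; first exact: fe.
  exact: (steklov_modulus h i _ d e h0 (cs r) IH).
elim: s => [|i s IH] x /=; first by rewrite subrr normr0 mul0r.
rewrite -(subrKA (steklov_iter h s f x)) mulrSr mulrDl mul1r addrC.
rewrite (le_trans (ler_normD _ _)) // lerD //.
exact: (steklov_close h i _ d e hd (cs s) (modulus s)).
Qed.

Lemma is_derive_steklov_iter h s j f : 0 < h -> continuous_periodic f ->
  (forall x, derivable f x 'e_j) -> continuous_periodic ('D_('e_j) f) ->
  forall x, is_derive x 'e_j (steklov_iter h s f)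
                             (steklov_iter h s ('D_('e_j) f) x).
Proof.
move=> h0 cf df cDf; elim: s => [|i s IH] x /=; first exact: derivableP.
have DE : 'D_('e_j) (steklov_iter h s f) = steklov_iter h s ('D_('e_j) f).
  by apply/funext => y; have [_ ->] := IH y.
rewrite -DE; apply: (is_derive_steklov _ _ _ _ h0).
- exact: (continuous_periodic_steklov_iter _ _ _ h0 cf).1.
- by move=> y; have [] := IH y.
- by rewrite DE; exact: continuous_periodic_steklov_iter.
Qed.

(** The derivative along [e_j] is gained at an average in direction [j], where it is a difference
    quotient; the averages applied outside it in other directions commute with it and preserve its
    continuity. *)
Lemma derivable_steklov_iter h (s : seq 'I_n) j f : 0 < h ->
  continuous_periodic f -> j \in s ->
  (forall x, derivable (steklov_iter h s f) x 'e_j) /\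
  continuous_periodic ('D_('e_j) (steklov_iter h s f)).
Proof.
move=> h0 cf; elim: s => [//|i s IH]; rewrite inE => js /=.
have [cs ps] := continuous_periodic_steklov_iter h s f h0 cf.
have [<-|ji] := eqVneq j i.
  have H := is_derive_steklov_self h j _ h0 cs.
  split=> [x|]; first by have [] := H x.
  rewrite (_ : 'D_('e_j) _ = fun x =>
    (steklov_iter h s f (x + h *: 'e_j) - steklov_iter h s f x) / h).
    split; last by move=> x m; rewrite addrAC !ps.
    have cT (x : 'rV[R]_n) : {for x, continuous (fun y => y + h *: 'e_j)}.
      by apply: continuousD; [exact: cvg_id|exact: cst_continuous].
    have cS (x : 'rV[R]_n) :
        {for x, continuous (fun x => steklov_iter h s f (x + h *: 'e_j))}.
      by apply: continuous_comp; [exact: cT|exact: cs].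
    have cB (x : 'rV[R]_n) : {for x, continuous (fun x =>
      (steklov_iter h s f (x + h *: 'e_j) - steklov_iter h s f x) / h)}.
      by apply: continuousM; [apply: continuousB; [exact: cS|exact: cs]|
         exact: cst_continuous].
    exact: cB.
  by apply/funext => x; have [_ ->] := H x.
move: js; rewrite (negPf ji) /= => /IH [dS cD].
have H := is_derive_steklov h i j _ h0 cs dS cD.
split=> [x|]; first by have [] := H x.
rewrite (_ : 'D_('e_j) _ = steklov h i ('D_('e_j) (steklov_iter h s f))).
  exact: continuous_periodic_steklov.
by apply/funext => x; have [_ ->] := H x.
Qed.

End Smoothing.

(** * Periodic functions of class C^k and C^2 approximation *)

Section Regularity.
Context {R : realType} {n : nat}.
Implicit Types (f : 'rV[R]_n -> R) (x y u v : 'rV[R]_n).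

Lemma Zperiodic_derive f v : Zperiodic f -> Zperiodic ('D_v f).
Proof.
move=> pf x m; pose Q y (h : R) := h^-1 *: ((f \o shift y) (h *: v) - f y).
have QE : Q (x + map_mx (intr : int -> R) m) = Q x.
  by apply/funext => h; rewrite /Q /= addrA !pf.
by rewrite -[LHS]/(lim (Q _ @ 0^')) QE.
Qed.

Lemma continuous_lincomb (T : topologicalType) (I : finType) (a : I -> R)
    (g : I -> T -> R) :
  (forall i, continuous (g i)) -> continuous (fun z => \sum_i a i * g i z).
Proof.
move=> cg; apply: continuous_sumr => i z.
by apply: cvgM; [exact: cvg_cst|exact: cg].
Qed.

Lemma CkT_S k f : CkT k.+1 f -> CkT k f.
Proof.
move=> [Cf pf]; split=> //; move: Cf; clear pf.
elim: k f => [|k IH] f [df cf].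
  by move=> x; exact: differentiable_continuous.
by split=> // v; exact: IH.
Qed.

Lemma CkT_derive k f v : CkT k.+1 f -> CkT k ('D_v f).
Proof. by move=> [[_ cf] pf]; split; [exact: cf|exact: Zperiodic_derive]. Qed.

(** [Ck] quantifies over all directions; differentiability makes each directional derivative a
    linear combination of the partials. *)
Lemma Ck1_partials f : (forall i x, derivable f x 'e_i) ->
  (forall i, continuous ('D_('e_i) f)) -> Ck 1 f.
Proof.
move=> df cDf; have dif := differentiable_partials _ df cDf; split=> // v.
rewrite (_ : 'D_v f = fun x => \sum_i v 0 i * 'D_('e_i) f x); last first.
  by apply/funext => x; exact: derive_sum_partials.
exact: continuous_lincomb.
Qed.

Lemma Ck1_sum (a : 'I_n -> R) (g : 'I_n -> 'rV[R]_n -> R) :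
  (forall i, Ck 1 (g i)) -> Ck 1 (fun x => \sum_i a i * g i x).
Proof.
move=> Cg; have sE : (fun x => \sum_i a i * g i x) = \sum_i (a i *: g i).
  by apply/funext => x; rewrite fct_sumE.
have dg i x : differentiable (a i *: g i) x.
  by apply: differentiableZ; exact: (Cg i).1.
split=> [x|v]; first by rewrite sE; exact: differentiable_sum.
have -> : 'D_v (fun x => \sum_i a i * g i x) = fun x => \sum_i a i * 'D_v (g i) x.
  apply/funext => x; rewrite sE derive_sum; last first.
    by move=> i; exact: diff_derivable.
  apply: eq_bigr => i _; rewrite deriveZ //; exact/diff_derivable/(Cg i).1.
by apply: continuous_lincomb => i; exact: (Cg i).2.
Qed.

Lemma Ck2_partials f : (forall i x, derivable f x 'e_i) ->
  (forall i, Ck 1 ('D_('e_i) f)) -> Ck 2 f.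
Proof.
move=> df CDf.
have cDf i : continuous ('D_('e_i) f).
  by move=> x; apply: differentiable_continuous; exact: (CDf i).1.
have dif := differentiable_partials _ df cDf; split=> // v.
rewrite (_ : 'D_v f = fun x => \sum_i v 0 i * 'D_('e_i) f x); last first.
  by apply/funext => x; exact: derive_sum_partials.
exact: Ck1_sum.
Qed.

(** Average [f] over all [n] directions. The partials of the result are the averages of the
    continuous partials of [f]: they are therefore C^1, and close to the original partials. *)
Lemma C1_approx f (e : R) : 0 < e -> CkT 1 f ->
  exists2 g, CkT 2 g & forall i x, `|'D_('e_i) g x - 'D_('e_i) f x| <= e.
Proof.
move=> e0 Cf; have [[df _] pf] := Cf.
have cf : continuous_periodic f by exact: (@CkT_S 0).
have cDf i : continuous_periodic ('D_('e_i) f) by exact: (@CkT_derive 0).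
have ddf i x : derivable f x 'e_i by exact: diff_derivable.
pose s := enum 'I_n.
have e'0 : 0 < e / n.+1%:R by rewrite divr_gt0.
(* One [h] lies below the moduli of all [n] partial derivatives. *)
near (0 : R)^'+ => h.
have h0 : 0 < h by [].
have Hh (i : 'I_n) : exists2 d : R, 0 < h < d & forall x y, `|y - x| < d ->
    `|'D_('e_i) f y - 'D_('e_i) f x| <= e / n.+1%:R.
  move: i; near: h; apply: filter_forall => i.
  have [d d0 Hd] := periodic_unif _ (cDf i).1 (cDf i).2 _ e'0.
  near=> h; exists d => //; apply/andP; split; near: h.
    exact: nbhs_right_gt.
  exact: nbhs_right_lt.
have dS i := is_derive_steklov_iter h s i _ h0 cf (ddf i) (cDf i).
have DSE i : 'D_('e_i) (steklov_iter h s f) = steklov_iter h s ('D_('e_i) f).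
  by apply/funext => x; have [_ ->] := dS i x.
exists (steklov_iter h s f).
  split; last exact: (continuous_periodic_steklov_iter _ _ _ h0 cf).2.
  apply: Ck2_partials => [i x|i]; first by have [] := dS i x.
  rewrite DSE; apply: Ck1_partials => [j x|j].
    have [dSj _] := derivable_steklov_iter h s j _ h0 (cDf i) (mem_enum _ j).
    exact: dSj.
  by have [_ []] := derivable_steklov_iter h s j _ h0 (cDf i) (mem_enum _ j).
move=> i x; have [_ ->] := dS i x; have [d hd Hd] := Hh i.
(* There are [n] averages, each costing [e / n.+1]. *)
rewrite (le_trans (steklov_iter_close h s _ d _ hd (cDf i) Hd x)) //.
by rewrite size_enum_ord mulrA ler_pdivrMr // mulrC ler_wpM2l ?ltW // ltr_nat.
Unshelve. all: by end_near. Qed.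

End Regularity.

(** * The generator and the weighted space *)

Section Generator.
Context {R : realType} {n : nat}.
Implicit Types (f : 'rV[R]_n -> R) (x y u v w p : 'rV[R]_n).
Implicit Types (F : 'rV[R]_n * 'rV[R]_n -> R).

Lemma coord_le_enorm v i : `|v 0 i| <= enorm v.
Proof.
rewrite -sqrtr_sqr ler_wsqrtr // /dot (bigD1 i) //= expr2 lerDl.
by apply: sumr_ge0 => j _; rewrite -expr2 sqr_ge0.
Qed.

Lemma enorm_ge0 v : 0 <= enorm v.
Proof. exact: sqrtr_ge0. Qed.

Lemma enormZ (a : R) v : enorm (a *: v) = `|a| * enorm v.
Proof.
rewrite /enorm (_ : dot _ _ = a ^+ 2 * dot v v).
  by rewrite sqrtrM ?sqr_ge0 // sqrtr_sqr.
by rewrite /dot mulr_sumr; apply: eq_bigr => i _; rewrite !mxE; ring.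
Qed.

Lemma sum_coord_le v (b : 'I_n -> R) (B : R) : (forall i, `|b i| <= B) ->
  `|\sum_i v 0 i * b i| <= n%:R * B * enorm v.
Proof.
move=> bB; rewrite (le_trans (ler_norm_sum _ _ _)) //.
rewrite (@le_trans _ _ (\sum_(i < n) B * enorm v)) //.
  apply: ler_sum => i _; rewrite normrM mulrC ler_pM ?coord_le_enorm //.
by rewrite sumr_const card_ord -mulrA mulr_natl.
Qed.

Lemma genAE (sigma : R) f (z : 'rV[R]_n * 'rV[R]_n) : genA sigma f z =
  sigma ^+ 2 / 2 * laplacian f z.1 + \sum_i z.2 0 i * 'D_('e_i) f z.1.
Proof.
by rewrite /genA /dot; congr (_ + _); apply: eq_bigr => i _; rewrite mxE.
Qed.

Lemma genA0E f (z : 'rV[R]_n * 'rV[R]_n) :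
  genA 0 f z = \sum_i z.2 0 i * 'D_('e_i) f z.1.
Proof.
by rewrite genAE expr0n /= (mul0r 2^-1) (mul0r (laplacian f z.1)) add0r.
Qed.

Section Weight.
Context (gamma : R -> R).
Context (gamma_ge1 : forall r : R, 0 <= r -> 1 <= gamma r).

Lemma weight_gt0 v : 0 < gamma (enorm v).
Proof. by apply: lt_le_trans (gamma_ge1 _ (enorm_ge0 v)). Qed.

Let w_gt0 := weight_gt0.

Lemma gnorm_le F (a : R) : (forall z, `|F z| <= a * gamma (enorm z.2)) ->
  (Defs.gnorm gamma F <= a%:E)%E.
Proof.
move=> Fa; apply: ge_ereal_sup => _ [z _ <-]; rewrite lee_fin normrM normfV.
by rewrite (gtr0_norm (weight_gt0 _)) ler_pdivrMr.
Qed.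

Lemma gnorm_lt_le F (a : R) : (Defs.gnorm gamma F < a%:E)%E ->
  forall z, `|F z| <= a * gamma (enorm z.2).
Proof.
move=> Fa z; rewrite -ler_pdivrMr // -[X in _ / X](gtr0_norm (weight_gt0 _)).
rewrite -normfV -normrM -lee_fin; apply: le_trans (ltW Fa).
by apply: ereal_sup_ubound; exists z.
Qed.

Context (v_gamma :
  enorm z.2 / gamma (enorm z.2) @[z --> @vinfty R n] --> (0 : R)).

(** Beyond some [K] the ratio is at most 1; up to [K], [gamma >= 1] makes the constant [K]
    sufficient. *)
Lemma enorm_le_gamma : exists2 C, 0 < C & forall v, enorm v <= C * gamma (enorm v).
Proof.
have /cvgr0Pnorm_le /(_ _ ltr01) [K _ HK] := v_gamma.
exists (Num.max 1 K); first by rewrite lt_max ltr01.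
move=> v; have [vK|vK] := leP (enorm v) K.
  rewrite (le_trans vK) // (@le_trans _ _ (Num.max 1 K * 1)) //.
    by rewrite mulr1 le_max lexx orbT.
  rewrite ler_wpM2l ?gamma_ge1 ?enorm_ge0 // le_max ler01 //.
have := HK (0, v) vK.
rewrite /= normrM normfV !ger0_norm ?enorm_ge0 ?(ltW (weight_gt0 _)) //.
rewrite ler_pdivrMr // => /le_trans; apply.
by rewrite ler_wpM2r ?(ltW (weight_gt0 _)) // le_max lexx.
Qed.

Lemma C0gamma_affine (a : 'rV[R]_n -> R) (b : 'I_n -> 'rV[R]_n -> R) :
  continuous_periodic a -> (forall i, continuous_periodic (b i)) ->
  C0gamma gamma (fun z : 'rV[R]_n * 'rV[R]_n => a z.1 + \sum_i z.2 0 i * b i z.1).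
Proof.
move=> [ca pa] cpb.
have [A A0 aA] := periodic_bounded _ ca pa.
have [B B0 bB] : exists2 B, 0 <= B & forall i x, `|b i x| <= B.
  have /fin_all_exists [Bi HB] i : exists B, forall x, `|b i x| <= B.
    by have [B _] := periodic_bounded _ (cpb i).1 (cpb i).2; exists B.
  exists (\sum_i `|Bi i|) => [|i x]; first exact: sumr_ge0.
  rewrite (le_trans (HB i x)) // (le_trans (ler_norm _)) // (bigD1 i) //=.
  by rewrite lerDl sumr_ge0.
have bound (z : 'rV[R]_n * 'rV[R]_n) :
    `|a z.1 + \sum_i z.2 0 i * b i z.1| <= A + n%:R * B * enorm z.2.
  by rewrite (le_trans (ler_normD _ _)) // lerD // sum_coord_le.
split.
- have c1 (g : 'rV[R]_n -> R) (z : 'rV[R]_n * 'rV[R]_n) : continuous g ->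
      {for z, continuous (fun z : 'rV[R]_n * 'rV[R]_n => g z.1)}.
    by move=> cg; apply: continuous_comp; [exact: cvg_fst|exact: cg].
  have c2 i (z : 'rV[R]_n * 'rV[R]_n) :
      {for z, continuous (fun z : 'rV[R]_n * 'rV[R]_n => z.2 0 i)}.
    apply: (@continuous_comp _ _ _ snd (fun v : 'rV[R]_n => v 0 i)).
      exact: cvg_snd.
    exact: coord_continuous.
  have cs i (z : 'rV[R]_n * 'rV[R]_n) :
      {for z, continuous (fun z : 'rV[R]_n * 'rV[R]_n => z.2 0 i * b i z.1)}.
    by apply: continuousM; [exact: c2|exact/c1/(cpb i).1].
  have cab (z : 'rV[R]_n * 'rV[R]_n) : {for z, continuous
      (fun z : 'rV[R]_n * 'rV[R]_n => a z.1 + \sum_i z.2 0 i * b i z.1)}.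
    by apply: continuousD; [exact: c1|exact: continuous_sumr].
  exact: cab.
- move=> v x m /=; rewrite pa; congr (_ + _); apply: eq_bigr => i _.
  by rewrite (cpb i).2.
- have [C C0 HC] := enorm_le_gamma.
  apply: (@le_lt_trans _ _ (A + n%:R * B * C)%:E); last exact: ltry.
  apply: gnorm_le => z; rewrite (le_trans (bound z)) // mulrDl lerD //.
    by rewrite ler_peMr // gamma_ge1 // enorm_ge0.
  by rewrite -[leRHS]mulrA ler_wpM2l // mulr_ge0.
- apply/cvgr0Pnorm_le => e e0.
  (* For [|v| > 1] the function is at most [(A + n B) |v|] in absolute value; the extra 1 makes the
     divisor positive. *)
  have D0 : 0 < A + n%:R * B + 1 by rewrite ltr_wpDl // addr_ge0 // mulr_ge0.
  have e'0 : 0 < e / (A + n%:R * B + 1) by rewrite divr_gt0.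
  have /cvgr0Pnorm_le /(_ _ e'0) [K _ HK] := v_gamma.
  exists (Num.max 1 K) => // z /=; rewrite gt_max => /andP[z1 /HK].
  rewrite !normrM !normfV (gtr0_norm (weight_gt0 _)) (ger0_norm (enorm_ge0 _)).
  rewrite !ler_pdivrMr // mulrAC ler_pdivlMr // => H.
  apply: (le_trans (bound z)); apply: le_trans H.
  have HA : A <= enorm z.2 * A by rewrite ler_peMl // ltW.
  have := enorm_ge0 z.2; rewrite !mulrDr mulr1; move: HA.
  rewrite (mulrC (enorm _) (_ * B)).
  lra.
Qed.

End Weight.
End Generator.

(** * The closure of the range of the generator *)

Section Closure.
Context {R : realType} {n : nat}.
Notation Omega := ('rV[R]_n * 'rV[R]_n)%type.
Implicit Types (f : 'rV[R]_n -> R) (x u v w p : 'rV[R]_n) (F : Omega -> R).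
Context (gamma : R -> R).
Context (gamma_ge1 : forall r : R, 0 <= r -> 1 <= gamma r).
Context (v_gamma :
  enorm z.2 / gamma (enorm z.2) @[z --> @vinfty R n] --> (0 : R)).

Lemma genA_C0gamma sigma k f : k = 2%N \/ (sigma = 0 /\ k = 1%N) ->
  CkT k f -> C0gamma gamma (genA sigma f).
Proof.
move=> k_adm Cf.
have C1f : CkT 1 f by case: k_adm Cf => [->|[_ ->]] // /CkT_S.
have -> : genA sigma f = fun z : Omega =>
    sigma ^+ 2 / 2 * laplacian f z.1 + \sum_i z.2 0 i * 'D_('e_i) f z.1.
  by apply/funext => z; exact: genAE.
apply: (C0gamma_affine _ gamma_ge1 v_gamma
  (fun x => sigma ^+ 2 / 2 * laplacian f x) (fun i => 'D_('e_i) f)) => [|i];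
  last first.
  exact: (@CkT_derive _ _ 0).
(* When [sigma = 0] and [f] is only C^1, the zero coefficient removes the Laplacian, whose
   continuity is unknown. *)
case: k_adm Cf => [->|[-> _]] Cf; last first.
  have -> : (fun x => 0 ^+ 2 / 2 * laplacian f x) = cst (0 : R).
    by apply/funext => x; rewrite expr0n /= (mul0r 2^-1) (mul0r (laplacian f x)).
  by split=> [|x m //]; exact: cst_continuous.
have CD i : continuous_periodic ('D_('e_i) ('D_('e_i) f)).
  by apply: (@CkT_derive _ _ 0); exact: (@CkT_derive _ _ 1).
split=> [|x m].
  have -> : (fun x => sigma ^+ 2 / 2 * laplacian f x) =
      fun x => \sum_i sigma ^+ 2 / 2 * 'D_('e_i) ('D_('e_i) f) x.
    by apply/funext => x; rewrite /laplacian mulr_sumr.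
  by apply: continuous_lincomb => i; exact: (CD i).1.
have -> : laplacian f (x + map_mx (intr : int -> R) m) = laplacian f x.
  by apply: eq_bigr => i _; have [_ pD] := CD i; exact: pD.
by [].
Qed.

Lemma genA_closure sigma k f : k = 2%N \/ (sigma = 0 /\ k = 1%N) ->
  CkT k f -> Cclosure sigma gamma k (genA sigma f).
Proof.
move=> k_adm Cf; split=> [|e e0]; first exact: genA_C0gamma Cf.
exists f => //; apply: (@le_lt_trans _ _ 0%:E); last by rewrite lte_fin.
by apply: gnorm_le => // z; rewrite subrr normr0 mul0r.
Qed.

(** For [sigma = 0] the generator involves the gradient only, so a uniform gradient error is
    multiplied by [|v|], which [C * gamma] dominates. *)
Lemma genA0_closure f : CkT 1 f -> Cclosure 0 gamma 2 (genA 0 f).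
Proof.
move=> Cf; split=> [|e e0]; first by apply: genA_C0gamma Cf; right.
have [C C0 HC] := enorm_le_gamma _ gamma_ge1 v_gamma.
have d0 : 0 < e / 2 / (n.+1%:R * C) by rewrite !divr_gt0 // mulr_gt0.
have [g Cg Dg] := C1_approx _ _ d0 Cf.
exists g => //; apply: (@le_lt_trans _ _ (e / 2)%:E); last first.
  by rewrite lte_fin ltr_pdivrMr // ltr_pMr // ltrDl.
apply: (gnorm_le _ gamma_ge1) => z.
rewrite (genA0E f) (genA0E g) -sumrB.
under eq_bigr do rewrite -mulrBr.
have fg i : `|'D_('e_i) f z.1 - 'D_('e_i) g z.1| <= e / 2 / (n.+1%:R * C).
  by rewrite distrC; exact: Dg.
apply: le_trans (sum_coord_le _ _ _ fg) _.
apply: le_trans (ler_wpM2l _ (HC _)) _; first by rewrite mulr_ge0 // ltW.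
rewrite [leLHS]mulrA ler_wpM2r //; first exact/ltW/weight_gt0.
rewrite (_ : n%:R * _ * C = e / 2 * (n%:R / n.+1%:R)); last first.
  by rewrite -natr1; field; rewrite nat1r pnatr_eq0 /= gt_eqF.
rewrite ler_piMr ?divr_ge0 ?(ltW e0) // ler_pdivrMr // mul1r ler_nat //.
Qed.

Lemma genA_affine sigma f x v w (t : R) :
  genA sigma f (x, t *: v + (1 - t) *: w) =
  t * genA sigma f (x, v) + (1 - t) * genA sigma f (x, w).
Proof.
have sumE : \sum_i (t *: v + (1 - t) *: w) 0 i * 'D_('e_i) f x =
    t * (\sum_i v 0 i * 'D_('e_i) f x) + (1 - t) * (\sum_i w 0 i * 'D_('e_i) f x).
  rewrite !mulr_sumr -big_split; apply: eq_bigr => i _.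
  by rewrite !mxE /=; ring.
by rewrite !genAE /= sumE; ring.
Qed.

(** Convergence in the weighted norm is pointwise, and an affine identity passes to pointwise
    limits. *)
Lemma closure_affine sigma k F x v w (t : R) : Cclosure sigma gamma k F ->
  F (x, t *: v + (1 - t) *: w) = t * F (x, v) + (1 - t) * F (x, w).
Proof.
move=> [_ FC]; set u := t *: v + _.
apply/eqP; rewrite -subr_eq0 -normr_le0; apply/ler_addgt0Pl => e e0; rewrite addr0.
(* [M] collects the weights at the three evaluation points, so accuracy [e / M] gives a total error
   of at most [e]. *)
pose M := gamma (enorm u) + `|t| * gamma (enorm v) + `|1 - t| * gamma (enorm w).
have g0 (y : 'rV[R]_n) : 0 < gamma (enorm y) by exact: weight_gt0.
have M0 : 0 < M by rewrite !ltr_wpDr // mulr_ge0 // ltW.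
have [f _ /gnorm_lt_le Hf] := FC _ (divr_gt0 e0 M0).
have := genA_affine sigma f x v w t; rewrite -/u => /eqP.
rewrite -subr_eq0 => /eqP E.
rewrite -[X in `|X|]subr0 -E.
have Hu := Hf gamma_ge1 (x, u); have Hv := Hf gamma_ge1 (x, v).
have Hw := Hf gamma_ge1 (x, w).
rewrite (_ : _ - _ - _ = (F (x, u) - genA sigma f (x, u)) -
   t * (F (x, v) - genA sigma f (x, v)) -
   (1 - t) * (F (x, w) - genA sigma f (x, w))); last by ring.
rewrite (le_trans (ler_normB _ _)) // normrM.
apply: (@le_trans _ _ (e / M * M)); last by rewrite divfK // gt_eqF.
rewrite [X in _ <= X]mulrDr lerD //; last by rewrite mulrCA ler_wpM2l.
rewrite (le_trans (ler_normB _ _)) // normrM mulrDr lerD //.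
by rewrite mulrCA ler_wpM2l.
Qed.

Context (L : Omega -> R).
Context (L_gamma : L z / gamma (enorm z.2) @[z --> vinfty] --> +oo).

Lemma closure_approx_sup sigma k F (m e : R) : Cclosure sigma gamma k F ->
  (forall z, - F z - L z <= m) -> 0 < e ->
  exists2 f, CkT k f & forall z, - genA sigma f z - L z <= m + e.
Proof.
move=> CF Fm e0; have [[_ _ _ F0] FC] := CF.
have g0 (y : 'rV[R]_n) : 0 < gamma (enorm y) by exact: weight_gt0.
(* In [2 + |m|], one unit absorbs [F] and one the approximation error; the rest leaves at most
   [-|m|], hence at most [m]. *)
have [K1 _ HK1] : \forall z \near @vinfty R n, `|F z| <= gamma (enorm z.2) /\
    (2 + `|m|) * gamma (enorm z.2) <= L z.
  have /cvgr0Pnorm_le /(_ _ ltr01) H1 := F0.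
  move/cvgryPge : L_gamma => /(_ (2 + `|m|)) H2.
  near=> z; split.
    rewrite -[leRHS]mul1r -ler_pdivrMr // -[X in _ / X](gtr0_norm (g0 _)).
    by rewrite -normfV -normrM; near: z.
  by rewrite -ler_pdivlMr //; near: z.
pose K := Num.max 1 K1.
have K0 : 0 < K by rewrite lt_max ltr01.
(* The three bounds serve [|v| > K], [v = 0] and the sphere [|v| = K] respectively. *)
pose d := Num.min 1 (Num.min (e / gamma 0) (e / gamma K)).
have [gz gK] : 0 < gamma 0 /\ 0 < gamma K.
  by split; apply: lt_le_trans (gamma_ge1 _ _) => //; exact: ltW.
have d0 : 0 < d by rewrite !lt_min ltr01 !divr_gt0.
have [d1 dz dK] : [/\ d <= 1, d * gamma 0 <= e & d * gamma K <= e].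
  by split; rewrite -?ler_pdivlMr // !ge_min lexx ?orbT.
have [f Cf /gnorm_lt_le Hf] := FC _ d0.
exists f => // -[x v].
have [vK|vK] := ltP K (enorm v); last first.
  suff H : `|F (x, v) - genA sigma f (x, v)| <= e.
    have := Fm (x, v); move: H; rewrite ler_norml; lra.
  have [v0|v0] := eqVneq (enorm v) 0.
    by rewrite (le_trans (Hf gamma_ge1 _)) //= v0.
  have vgt0 : 0 < enorm v by rewrite lt_neqAle eq_sym v0 enorm_ge0.
  (* [v] lies on the diameter from [-u] to [u] of the ball of radius [K]; [t] solves
     [2 t - 1 = |v| / K]. The error at [v] is then a convex combination of the errors at [u] and
     [-u]. *)
  pose u := (K / enorm v) *: v; pose t := (1 + enorm v / K) / 2.
  have vE : v = t *: u + (1 - t) *: (- u).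
    rewrite scalerN -scaleNr -scalerDl /u scalerA (_ : _ * _ = 1) ?scale1r // /t.
    by field; rewrite v0 /= gt_eqF.
  have uK : enorm u = K by rewrite enormZ gtr0_norm ?divr_gt0 // divfK.
  have NuK : enorm (- u) = K by rewrite -scaleN1r enormZ normrN1 mul1r.
  have t01 : 0 <= t <= 1.
    have : 0 <= enorm v / K <= 1.
      by rewrite divr_ge0 ?enorm_ge0 ?(ltW K0) //= ler_pdivrMr // mul1r.
    by rewrite /t; lra.
  rewrite vE (closure_affine _ _ _ _ _ _ _ CF) genA_affine.
  have := Hf gamma_ge1 (x, u); have := Hf gamma_ge1 (x, - u).
  rewrite /= uK NuK !ler_norml; nra.
have [//|FK LK] := HK1 (x, v).
  by rewrite /= (le_lt_trans _ vK) // le_max lexx orbT.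
have := Hf gamma_ge1 (x, v); move: FK LK; rewrite /= => FK LK HF.
have mg : `|m| <= `|m| * gamma (enorm v)
  by rewrite ler_peMr // gamma_ge1 // enorm_ge0.
have dg : d * gamma (enorm v) <= gamma (enorm v) by rewrite ler_piMl // ltW.
have mm : - `|m| <= m by rewrite lerNl -normrN ler_norm.
move: FK HF; rewrite !ler_norml; lra.
Unshelve. all: by end_near. Qed.

End Closure.

(* k is the regularity of the test functions in the definition of the closed
   set on which h2 = 0: C^2, or alternatively C^1 when sigma = 0. *)
Theorem theorem4 (R : realType) (n : nat) (sigma : R)
    (L : 'rV[R]_n * 'rV[R]_n -> R) (gamma : R -> R) (k : nat)
    (sigma_ge0 : 0 <= sigma)
    (L_smooth : smooth L)
    (L_periodic : Zperiodic_x L)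
    (L_coercive : L z @[z --> vinfty] --> +oo)
    (L_convex : forall x, strictly_convex (fun v => L (x, v)))
    (L_ge0 : forall z, 0 <= L z)
    (gamma_ge1 : forall r : R, 0 <= r -> 1 <= gamma r)
    (L_gamma : L z / gamma (enorm z.2) @[z --> vinfty] --> +oo)
    (v_gamma : enorm z.2 / gamma (enorm z.2)
                 @[z --> @vinfty R n] --> (0 : R))
    (k_adm : k = 2%N \/ (sigma = 0 /\ k = 1%N)) :
  Hstar sigma L gamma k =
  ereal_inf [set lambda%:E | lambda in
    [set lambda : R | exists2 varphi : 'rV[R]_n -> R,
       CkT (if sigma == 0 then 1%N else 2%N) varphi &
       forall x : 'rV[R]_n,
         ((- (sigma ^+ 2 / 2 * laplacian varphi x))%:E
            + hamiltonian L (grad varphi x) x < lambda%:E)%E]].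
Proof.
set S := [set lambda : R | _].
apply/eqP; rewrite eq_le; apply/andP; split.
(* Each admissible [lam] with its function [f] gives the competitor [genA sigma f], for which [h1]
   is at most [lam]. *)
- apply: le_ereal_inf_tmp => _ [lam [f Cf Hf] <-]; rewrite /Hstar leeNl.
  have [CA h1A] : Cclosure sigma gamma k (genA sigma f) /\
      (h1 L (genA sigma f) <= lam%:E)%E.
    split.
      case: k_adm Cf => [->|[-> ->]]; last first.
        by rewrite eqxx => Cf; apply: genA_closure => //; right.
      (* Here [k = 2]; if [sigma = 0] the function [f] is only C^1 and must be approximated. *)
      have [->|s0] := eqVneq sigma 0; first exact: genA0_closure.
      by apply: genA_closure => //; left.
    apply: ge_ereal_sup => _ [[x v] _ <-]; apply: le_trans (ltW (Hf x)).
    apply: (@le_trans _ _ ((- (sigma ^+ 2 / 2 * laplacian f x))%:E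
      + (- dot (grad f x) v - L (x, v))%:E)%E).
      rewrite -EFinD lee_fin /genA /= opprD addrA.
      by rewrite /dot; under [in leRHS]eq_bigr do rewrite mulrC.
    by rewrite leeD2l //; apply: ereal_sup_ubound; exists v.
  apply: (@le_trans _ _ (h2 sigma gamma k (genA sigma f) - h1 L (genA sigma f))%E).
    by rewrite /h2 mem_set // add0e leeN2.
  by apply: ereal_sup_ubound; exists (genA sigma f) => //; have [] := CA.
- rewrite /Hstar leeNr; apply: ge_ereal_sup => _ [F _ <-].
  rewrite /h2; case: ifPn => [/set_mem CF|_]; last by rewrite addNye leNye.
  rewrite add0e leeN2.
  have h1F z : ((- F z - L z)%:E <= h1 L F)%E by apply: ereal_sup_ubound; exists z.
  (* The value [-oo] is excluded because the supremum runs over a nonempty set, and [+oo] is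
     trivial. *)
  case E: (h1 L F) h1F => [m| |] h1F; first last.
  + by have := h1F (0, 0); rewrite leeNy_eq.
  + exact: leey.
  apply/lee_addgt0Pr => e e0; have e20 : 0 < e / 2 by rewrite divr_gt0.
  have [f Cf Hf] := closure_approx_sup _ gamma_ge1 _ L_gamma _ _ _ _ _ CF h1F e20.
  apply: ereal_inf_lbound; exists (m + e) => //; exists f.
    case: k_adm Cf => [->|[-> ->]]; last by rewrite eqxx.
    by case: ifP => _ // /CkT_S.
  (* Only [e / 2] is spent on the approximation, so that the inequality with [m + e] is strict even
     after taking the supremum over [v]. *)
  move=> x; apply: (@le_lt_trans _ _ (m + e / 2)%:E).
    rewrite addeC -leeBrDr // -EFinN opprK -EFinD.
    apply: ge_ereal_sup => _ [v _ <-]; rewrite lee_fin.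
    have := Hf (x, v); rewrite /genA /= opprD.
    rewrite /dot; under eq_bigr do rewrite mulrC.
    lra.
  by rewrite lte_fin ltrD2l ltr_pdivrMr // ltr_pMr // ltrDl.
Qed.
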